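(* Let $\mathbb{K}=\mathbb{R}$ or $\mathbb{C}$. For any matrix $A\in\mathbb{K}^{m\times n}$, any $s\in\{1,\ldots,n\}$ and any $k\ge s$ there exists a matrix $B\in\mathbb{K}^{n\times k}$ such that $$\operatorname{rank}B=s\quad\text{and}\quad(AB)^{+}=B^{+}A^{+}.$$
   Context: $M^{+}$ denotes the Moore--Penrose pseudoinverse of $M$. *)

(* Defs.v *)
From HB Require Import structures.
From mathcomp Require Import all_boot all_order all_algebra.
From mathcomp Require Import complex.
From mathcomp Require Import reals.

Set Implicit Arguments.
Unset Strict Implicit.
Unset Printing Implicit Defensive.
Import Order.TTheory GRing.Theory Num.Theory.
Local Open Scope ring_scope.
Local Open Scope sesquilinear_scope.

Section MoorePenrose.

(* [A ^t conj] is the conjugate transpose of A.  The hypothesis [normE] covers *)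
(* both the reals (conj = identity) and the complex numbers.                   *)
Variables (K : numFieldType) (conj : {rmorphism K -> K}).

Definition penrose m n (A : 'M[K]_(m, n)) (X : 'M[K]_(n, m)) : bool :=
  [&& A *m X *m A == A,
      X *m A *m X == X,
      (A *m X) ^t conj == A *m X
    & (X *m A) ^t conj == X *m A].

Lemma trC_mul m n p (A : 'M[K]_(m, n)) (B : 'M[K]_(n, p)) :
  (A *m B) ^t conj = B ^t conj *m A ^t conj.
Proof. by rewrite trmx_mul map_mxM. Qed.

Lemma trC_inv n (A : 'M[K]_n) : (invmx A) ^t conj = invmx (A ^t conj).
Proof. by rewrite trmx_inv map_invmx. Qed.

Lemma penrose_unique m n (A : 'M[K]_(m, n)) (X Y : 'M[K]_(n, m)) :
  penrose A X -> penrose A Y -> X = Y.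
Proof.
move=> /and4P[/eqP X1 /eqP X2 /eqP X3 /eqP X4].
move=> /and4P[/eqP Y1 /eqP Y2 /eqP Y3 /eqP Y4].
have AXY : A *m X = A *m Y.
  by rewrite -X3 -{1}Y1 -[_ *m A *m X]mulmxA trC_mul X3 Y3 mulmxA X1.
have XAY : X *m A = Y *m A.
  by rewrite -X4 -{1}Y1 -[A *m Y *m A]mulmxA mulmxA trC_mul X4 Y4 -mulmxA
             [A *m _]mulmxA X1.
by rewrite -X2 XAY -mulmxA AXY mulmxA Y2.
Qed.

Hypothesis normE : forall x : K, x * conj x = `|x| ^+ 2.

Lemma conj_involutive : involutive conj.
Proof.
move=> x; have [->|x0] := eqVneq x 0; first by rewrite !rmorph0.
have cx0 : conj x != 0 by rewrite fmorph_eq0.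
have H := normE x.
have Hn : conj (`|x| ^+ 2) = `|x| ^+ 2.
  have r0 : `|x| ^+ 2 != 0 by rewrite expf_neq0 // normr_eq0.
  apply: (mulfI r0); rewrite normE ger0_norm ?expr2 //.
  by rewrite mulr_ge0.
apply: (mulfI cx0); rewrite -rmorphM H Hn -H mulrC //.
Qed.

Lemma trCK m n (A : 'M[K]_(m, n)) : (A ^t conj) ^t conj = A.
Proof. by apply/matrixP=> i j; rewrite !mxE conj_involutive. Qed.

Lemma gram_unit r n (F : 'M[K]_(r, n)) :
  row_free F -> F *m F ^t conj \in unitmx.
Proof.
move=> Ffree; rewrite -row_free_unit -kermx_eq0; apply/eqP/row_matrixP => i.
rewrite row0; set u := row i _.
have uFF : u *m (F *m F ^t conj) = 0 by rewrite -row_mul mulmx_ker row0.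
have uF : u *m F = 0.
  have : ((u *m F) *m (u *m F) ^t conj) 0 0 = 0.
    by rewrite trC_mul mulmxA -[u *m F *m _]mulmxA uFF mul0mx mxE.
  rewrite mxE; under eq_bigr => j _ do rewrite !mxE -?mxE normE.
  move=> /eqP; rewrite psumr_eq0; last by move=> j _; rewrite exprn_ge0.
  move=> /allP H; apply/rowP => j.
  have := H j (mem_index_enum _); rewrite implyTb sqrf_eq0 normr_eq0.
  by rewrite !mxE => /eqP.
by apply/eqP; rewrite -(mulmx_free_eq0 _ Ffree) uF.
Qed.

Lemma penrose_exists m n (A : 'M[K]_(m, n)) : exists X, penrose A X.
Proof.
have [r [C [F [E fC fF]]]] : exists r (C : 'M[K]_(m, r)) (F : 'M[K]_(r, n)),
    [/\ A = C *m F, row_full C & row_free F].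
  exists (\rank A), (col_base A), (row_base A).
  by split; rewrite ?mulmx_base ?col_base_full ?row_base_free.
set G := F *m F ^t conj; set H := C ^t conj *m C.
have uG : G \in unitmx by apply: gram_unit.
have uH : H \in unitmx.
  rewrite /H -[X in _ *m X]trCK; apply: gram_unit.
  by rewrite /row_free mxrank_map mxrank_tr.
have GG : G ^t conj = G by rewrite /G trC_mul trCK.
have HH : H ^t conj = H by rewrite /H trC_mul trCK.
pose X := F ^t conj *m invmx G *m invmx H *m C ^t conj.
have AX : A *m X = C *m invmx H *m C ^t conj.
  rewrite E /X !mulmxA -[C *m F *m _]mulmxA -/G -[C *m G *m _]mulmxA.
  by rewrite mulmxV // mulmx1.
have XA : X *m A = F ^t conj *m invmx G *m F.
  rewrite E /X !mulmxA -[_ *m C ^t conj *m C]mulmxA -/H.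
  by rewrite -[_ *m invmx H *m H]mulmxA mulVmx // mulmx1.
exists X; apply/and4P; split; apply/eqP.
- rewrite AX {1}E !mulmxA -[_ *m C ^t conj *m C]mulmxA -/H.
  by rewrite -[_ *m invmx H *m H]mulmxA mulVmx // mulmx1 E.
- rewrite XA {1}/X !mulmxA -[_ *m F *m F ^t conj]mulmxA -/G.
  by rewrite -[_ *m invmx G *m G]mulmxA mulVmx // mulmx1.
- by rewrite AX !trC_mul trC_inv HH trCK mulmxA.
- by rewrite XA !trC_mul trC_inv GG trCK mulmxA.
Qed.

Definition mp_pinv m n (A : 'M[K]_(m, n)) : 'M[K]_(n, m) :=
  xchoose (penrose_exists A).

Lemma mp_pinvP m n (A : 'M[K]_(m, n)) : penrose A (mp_pinv A).
Proof. exact: xchooseP. Qed.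

Lemma mp_pinv_unique m n (A : 'M[K]_(m, n)) (X : 'M[K]_(n, m)) :
  penrose A X -> mp_pinv A = X.
Proof. exact: penrose_unique (mp_pinvP A). Qed.

End MoorePenrose.

Lemma real_normE (R : realFieldType) (x : R) : x * idfun x = `|x| ^+ 2.
Proof. by rewrite real_normK ?num_real. Qed.

Lemma complex_normE (C : numClosedFieldType) (x : C) :
  x * Num.conj x = `|x| ^+ 2.
Proof. by rewrite normCK. Qed.

Definition pinvR (R : realFieldType) m n (A : 'M[R]_(m, n)) : 'M[R]_(n, m) :=
  mp_pinv (@real_normE R) A.

Definition pinvC (C : numClosedFieldType) m n (A : 'M[C]_(m, n)) :
    'M[C]_(n, m) :=
  mp_pinv (@complex_normE C) A.

(* Main.v *)
Require Import Defs.
From HB Require Import structures.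
From mathcomp Require Import all_boot all_order all_algebra.
From mathcomp Require Import complex.
From mathcomp Require Import reals.
Import Order.TTheory GRing.Theory Num.Theory.
Local Open Scope ring_scope.

(** Write S for the hermitian matrix A^* A and choose B to be a partial
    isometry, B B^* B = B, so that B^+ = B^*; let P = B B^* be the orthogonal
    projection onto the column space of B.

    If P commutes with S, then (A B)^+ = B^* A^+ (lemma [reverse_order_law]).
    Indeed M = A^+ (A^+)^* is the pseudoinverse of S, and
    M S = S M = A^+ A.  A matrix that commutes with S commutes with such an M
    ([group_inverse_comm]), so P commutes both with M and with A^+ A.  Since
    A^+ = M A^*, the two products in the Penrose conditions are
      A B B^* A^+ = A (P M) A^*   and   B^* A^+ A B = B^* (A^+ A) B,
    which are visibly hermitian; the other two conditions follow by moving P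
    across A^+ A.

    A projection P of any rank s <= n that commutes with S comes from the
    spectral theorem: pick s orthonormal eigenvectors of S
    ([orthonormal_stable]), put them in the rows of V, and take
    B = V^* Q, where Q = [I_s 0] pads V^* with zero columns up to width k.
    Then B B^* = V^* V.

    Both scalar fields are treated at once, over a field with a conjugation
    satisfying x * conj x = |x|^2.  Two further facts depend on the field:
    nonnegative elements have the form y * conj y, and a nonzero subspace
    stable under a hermitian matrix contains an eigenvector.  The second is
    algebraic closedness for the complex numbers; it descends to the reals
    because a hermitian matrix has only real eigenvalues. *)

(** * Commutation with a group inverse *)

(** M is the group inverse of S, and E = M S = S M is idempotent.  Moving P
    across S turns both P E and E P into E P E, so P commutes with E; then
    P M = E P M = M P S M = M P E = M P. *)
Lemma group_inverse_comm (K : pzRingType) n (S M P : 'M[K]_n) :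
  S *m M = M *m S -> S *m M *m S = S -> M *m S *m M = M ->
  P *m S = S *m P -> P *m M = M *m P.
Proof.
move=> SM SMS MSM PS.
have PE : P *m (M *m S) = M *m S *m P.
  transitivity (M *m S *m P *m (M *m S)).
    by rewrite -SM -[in RHS]mulmxA [P *m _ in RHS]mulmxA PS !mulmxA SMS PS.
  by rewrite -(mulmxA M S P) -PS -!mulmxA [S *m (M *m S)]mulmxA SMS.
transitivity (M *m (S *m P) *m M).
  by rewrite -{1}MSM mulmxA PE !mulmxA.
by rewrite -PS -2!mulmxA SM PE !mulmxA -(mulmxA M M S) -SM !mulmxA MSM.
Qed.

(** * The reverse order law for a partial isometry *)

Section ReverseOrder.
Set Implicit Arguments.
Unset Strict Implicit.
Local Open Scope sesquilinear_scope.

Variables (K : numFieldType) (conj : {rmorphism K -> K}).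
Hypothesis normE : forall x : K, x * conj x = `|x| ^+ 2.

Local Notation "M ^*t" := (M ^t conj) (at level 30).
Local Notation pinv := (mp_pinv normE).

Let adjK {m n} (A : 'M[K]_(m, n)) : A ^*t ^*t = A := trCK normE A.

Lemma penrose_partial_isometry n k (B : 'M[K]_(n, k)) :
  B *m B ^*t *m B = B -> penrose conj B (B ^*t).
Proof.
move=> BBB; apply/and4P; split; apply/eqP; rewrite ?trC_mul ?adjK //.
by rewrite -[X in _ = X ^*t]BBB !trC_mul adjK mulmxA.
Qed.

(** For a general factor B the law amounts to invariance of the range of B
    under A^* A together with invariance of the range of A^* under B B^*.  For
    a partial isometry a single commutation gives both. *)
Lemma reverse_order_law m n k (A : 'M[K]_(m, n)) (B : 'M[K]_(n, k)) :
  B *m B ^*t *m B = B ->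
  B *m B ^*t *m (A ^*t *m A) = A ^*t *m A *m (B *m B ^*t) ->
  pinv (A *m B) = pinv B *m pinv A.
Proof.
move=> BBB PS; rewrite (mp_pinv_unique _ (penrose_partial_isometry BBB)).
set X := pinv A; set P := B *m B ^*t in BBB PS; set S := A ^*t *m A in PS.
have /and4P[/eqP AXA /eqP XAX /eqP hAX /eqP hXA] : penrose conj A X.
  exact: mp_pinvP.
have hP : P ^*t = P by rewrite /P trC_mul adjK.
(* M is the pseudoinverse of S; it is a group inverse since S is hermitian. *)
pose M := X *m X ^*t.
have hM : M ^*t = M by rewrite /M trC_mul adjK.
have MA : M *m A ^*t = X by rewrite /M -mulmxA -trC_mul hAX mulmxA.
have MS : M *m S = X *m A by rewrite /S mulmxA MA.
have SM : S *m M = X *m A.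
  by rewrite -hXA -MS trC_mul hM /S trC_mul adjK.
have PM : P *m M = M *m P.
  apply: group_inverse_comm PS; rewrite ?SM ?MS //.
    by rewrite -hXA /S mulmxA -trC_mul mulmxA AXA.
  by rewrite /M mulmxA XAX.
have PE : P *m (X *m A) = X *m A *m P.
  by rewrite -MS mulmxA PM -mulmxA PS mulmxA.
have ABX : A *m B *m (B ^*t *m X) = A *m (P *m M) *m A ^*t.
  by rewrite -MA !mulmxA.
have BXA : B ^*t *m X *m (A *m B) = B ^*t *m (X *m A) *m B.
  by rewrite !mulmxA.
have BP : B ^*t *m P = B ^*t by rewrite -hP -trC_mul BBB.
have defP : P = B *m B ^*t by [].
clearbody P.
apply: mp_pinv_unique; apply/and4P; split; apply/eqP.
- transitivity (A *m (P *m (X *m A)) *m B); first by rewrite defP !mulmxA.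
  by rewrite PE !mulmxA AXA -mulmxA BBB.
- transitivity (B ^*t *m (X *m A *m P) *m X); first by rewrite defP !mulmxA.
  by rewrite -PE mulmxA BP -!mulmxA [X *m (A *m X)]mulmxA XAX.
- by rewrite ABX 2!trC_mul adjK trC_mul hP hM -PM mulmxA.
- by rewrite BXA 2!trC_mul adjK hXA mulmxA.
Qed.

(** * Orthonormal eigenvectors of a hermitian matrix *)

Lemma dot_gt0 n (v : 'rV[K]_n) : v != 0 -> 0 < (v *m v ^*t) 0 0.
Proof.
move=> v0; rewrite mxE; under eq_bigr => j _ do rewrite !mxE normE.
have ge j : true -> 0 <= `|v 0 j| ^+ 2 by rewrite exprn_ge0.
rewrite lt0r sumr_ge0 // andbT psumr_eq0 //.
apply: contra v0 => /allP H; apply/eqP/rowP => j.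
have := H j (mem_index_enum _); rewrite implyTb sqrf_eq0 normr_eq0.
by rewrite mxE => /eqP.
Qed.

(** v S v^* = a v v^*, where v S v^* and v v^* are both self-conjugate and
    v v^* is nonzero. *)
Lemma hermitian_eigenvalue_real n (S : 'M[K]_n) (v : 'rV[K]_n) a :
  S ^*t = S -> v != 0 -> v *m S = a *: v -> conj a = a.
Proof.
move=> hS v0 vS.
have diag (T : 'M[K]_n) : T ^*t = T ->
    conj ((v *m T *m v ^*t) 0 0) = (v *m T *m v ^*t) 0 0.
  move=> hT; transitivity ((v *m T *m v ^*t) ^*t 0 0).
    by rewrite [RHS]mxE [X in _ = conj X]mxE.
  by rewrite 2!trC_mul adjK hT mulmxA.
have := diag _ hS; rewrite vS -scalemxAl mxE rmorphM.
have := diag 1%:M; rewrite tr_scalar_mx map_mx1 mulmx1 => -> //.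
exact/mulIf/lt0r_neq0/dot_gt0.
Qed.

Hypothesis sqrtE : forall x : K, 0 <= x -> exists y, y * conj y = x.

(* The eigenvector is asked for inside a stable subspace, so that one can be
   found in an orthogonal complement without choosing an orthonormal basis of
   that complement. *)
Hypothesis eigenE : forall n (S N : 'M[K]_n),
  S ^*t = S -> stablemx N S -> N != 0 ->
  exists a, (N :&: eigenspace S a)%MS != 0.

(** The rows of V are built one at a time: the orthogonal complement of a stable
    space is stable under a hermitian matrix, and as long as s < n it is nonzero,
    so it contains a further eigenvector, which is then normalised. *)
Lemma orthonormal_stable n (S : 'M[K]_n) s :
  S ^*t = S -> (s <= n)%N ->
  exists2 V : 'M[K]_(s, n), V *m V ^*t = 1%:M & stablemx V S.
Proof.
move=> hS; elim: s => [|s IHs] sn.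
  by exists 0; rewrite ?mul0mx ?sub0mx //; apply/matrixP; case.
have [V VV /submxP[T VS]] := IHs (ltnW sn).
pose N := kermx (V ^*t).
have stN : stablemx N S.
  apply/sub_kermxP.
  by rewrite -mulmxA -{1}hS -trC_mul VS trC_mul mulmxA mulmx_ker mul0mx.
have N0 : N != 0.
  rewrite -mxrank_eq0 mxrank_ker subn_eq0 -ltnNge (leq_ltn_trans _ sn) //.
  exact: rank_leq_col.
have [a /rowV0Pn[v]] := eigenE hS stN N0.
rewrite sub_capmx => /andP[/sub_kermxP vV /eigenspaceP vS] v0.
have vv0 := dot_gt0 v0; have [c cE] := sqrtE (ltW vv0).
have c0 : c != 0.
  by apply: contraTneq vv0 => c0; rewrite -cE c0 mul0r ltxx.
pose w := c^-1 *: v.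
have wV : w *m V ^*t = 0 by rewrite -scalemxAl vV scaler0.
have ww : w *m w ^*t = 1%:M.
  have -> : w ^*t = conj c^-1 *: v ^*t.
    by apply/matrixP => i j; rewrite !mxE rmorphM.
  rewrite -scalemxAl -scalemxAr scalerA fmorphV.
  rewrite [v *m _]mx11_scalar -cE scale_scalar_mx -invfM mulVf //.
  by rewrite mulf_neq0 // fmorph_eq0.
(* 1 + s is convertible to s.+1, and lets the block matrix lemmas apply. *)
change (exists2 W : 'M_(1 + s, n), W *m W ^*t = 1%:M & stablemx W S).
exists (col_mx w V).
  rewrite tr_col_mx map_row_mx mul_col_row wV VV ww.
  have -> : V *m w ^*t = 0 by rewrite -[V]adjK -trC_mul wV trmx0 map_mx0.
  by rewrite -scalar_mx_block.
rewrite mul_col_mx col_mx_sub; apply/andP; split.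
  rewrite -scalemxAl vS scalemx_sub // scalemx_sub //.
  by rewrite -[v](scalerKV c0) scalemx_sub // -addsmxE addsmxSl.
by rewrite VS mulmx_sub // -addsmxE addsmxSr.
Qed.

(** The rows of V span a stable space, V S = T V, hence P S = P S P for
    P = V^* V; taking adjoints, S P = P S P as well. *)
Lemma exists_reverse_order m n (A : 'M[K]_(m, n)) s k :
  (s <= n)%N -> (s <= k)%N ->
  exists B : 'M[K]_(n, k), \rank B = s /\ pinv (A *m B) = pinv B *m pinv A.
Proof.
move=> sn sk; set S := A ^*t *m A.
have hS : S ^*t = S by rewrite trC_mul adjK.
have [V VV /submxP[T VS]] := orthonormal_stable hS sn.
pose Q : 'M[K]_(s, k) := pid_mx s.
have QQ : Q *m Q ^*t = 1%:M.
  by rewrite tr_pid_mx map_pid_mx pid_mx_id // pid_mx_1.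
have BB : V ^*t *m Q *m (V ^*t *m Q) ^*t = V ^*t *m V.
  by rewrite trC_mul adjK mulmxA -(mulmxA _ Q) QQ mulmx1.
exists (V ^*t *m Q); split.
  apply/eqP; rewrite eqn_leq; apply/andP; split.
    by rewrite (leq_trans (mxrankM_maxl _ _)) // rank_leq_col.
  rewrite -{1}(rank_pid_mx K (leqnn s) sk) -/Q.
  by rewrite -{1}[Q]mul1mx -VV -mulmxA mxrankM_maxr.
apply: reverse_order_law; rewrite BB.
  by rewrite mulmxA -(mulmxA _ V) VV mulmx1.
set P := V ^*t *m V.
have hP : P ^*t = P by rewrite /P trC_mul adjK.
have PSP : P *m S = P *m S *m P.
  by rewrite /P -(mulmxA _ V S) VS !mulmxA -(mulmxA _ V (V ^*t)) VV mulmx1.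
rewrite -/S; clearbody P S.
transitivity ((P *m S) ^*t); last by rewrite trC_mul hS hP.
by rewrite PSP 2!trC_mul hS hP mulmxA.
Qed.
End ReverseOrder.

(** * Eigenvectors in stable subspaces *)

(** In a basis of N the action of S is a square matrix T of positive size; its
    eigenvectors are the coordinates of eigenvectors of S lying in N. *)
Lemma stable_eigenspace_closed (C : numClosedFieldType) n (S N : 'M[C]_n) :
  stablemx N S -> N != 0 -> exists a, (N :&: eigenspace S a)%MS != 0.
Proof.
move=> stN N0.
have /submxP[T NS] : stablemx (row_base N) S by rewrite stablemx_row_base.
have [|a /eigenvalueP[u uT u0]] := eigenvalue_closed T.
  by rewrite lt0n mxrank_eq0.
exists a; apply/rowV0Pn; exists (u *m row_base N).
  rewrite sub_capmx mulmx_sub ?eq_row_base //; apply/eigenspaceP.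
  by rewrite -mulmxA NS mulmxA uT scalemxAl.
by rewrite mulmx_free_eq0 ?row_base_free.
Qed.

(** Over the complex numbers N contains an eigenvector, whose eigenvalue is
    real; the dimension of the intersection of N with the eigenspace of that
    eigenvalue is the same over both fields, so it is nonzero over the reals
    already. *)
Lemma stable_eigenspace_real (R : rcfType) n (S N : 'M[R]_n) :
  S^T = S -> stablemx N S -> N != 0 ->
  exists a, (N :&: eigenspace S a)%MS != 0.
Proof.
move=> hS stN N0; pose f := real_complex R.
have [||a aE] := @stable_eigenspace_closed _ _ (map_mx f S) (map_mx f N).
- by rewrite -map_mxM map_submx.
- by rewrite map_mx_eq0.
have /rowV0Pn[v] := aE; rewrite sub_capmx => /andP[_ /eigenspaceP vS] v0.
have /CrealP/complex_realP[b ab] : Num.conj a = a.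
  apply: (hermitian_eigenvalue_real (@complex_normE _) _ v0 vS).
  apply/matrixP => i j; rewrite !mxE -{1}hS mxE.
  exact/CrealP/complex_realP/ex_intro.
exists b; move: aE; rewrite ab -[_%:C%C]/(f b) -map_eigenspace.
by rewrite -!mxrank_eq0 -map_capmx mxrank_map.
Qed.

(** * Both scalar fields *)

Theorem corollary3p4 (R : realType) :
  (forall (m n : nat) (A : 'M[R]_(m, n)) (s k : nat),
     (1 <= s <= n)%N -> (s <= k)%N ->
     exists B : 'M[R]_(n, k),
       \rank B = s /\ pinvR (A *m B) = pinvR B *m pinvR A)
  /\
  (forall (m n : nat) (A : 'M[R[i]]_(m, n)) (s k : nat),
     (1 <= s <= n)%N -> (s <= k)%N ->
     exists B : 'M[R[i]]_(n, k),
       \rank B = s /\ pinvC (A *m B) = pinvC B *m pinvC A).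
Proof.
split=> m n A s k /andP[_ sn] sk.
  apply: exists_reverse_order => // [x x0|p S N].
    by exists (Num.sqrt x); rewrite -expr2 sqr_sqrtr.
  by rewrite map_mx_id => [hS|//]; exact: stable_eigenspace_real.
apply: exists_reverse_order => // [x x0|p S N _].
  by exists (sqrtC x); rewrite -normCK ger0_norm ?sqrtC_ge0 // sqrtCK.
exact: stable_eigenspace_closed.
Qed.
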